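(* Let $\gamma$ be a hyperbolic isometry of three-dimensional Minkowski space $\mathbb{E}$ that has a fixed point, with linear part $g$, and let $C_\gamma$ be its ($\gamma$-invariant, here pointwise fixed) line. Choose the origin on $C_\gamma$ and set $$\mathcal{B}_\gamma=\{p_-\mathsf{x}^-(g)+p_+\mathsf{x}^+(g)+p_o\mathsf{x}^o(g) : p_-p_+<0\},$$ $$\mathcal{G}^+_\gamma=\{p_-\mathsf{x}^-(g)+p_+\mathsf{x}^+(g)+p_o\mathsf{x}^o(g) : p_-,p_+\ge 0\},\qquad \mathcal{G}^-_\gamma=\{p_-\mathsf{x}^-(g)+p_+\mathsf{x}^+(g)+p_o\mathsf{x}^o(g) : p_-,p_+\le 0\}.$$ Then $$\mathcal{F}(\langle\gamma\rangle)=(\mathcal{G}^+_\gamma\cup\mathcal{G}^-_\gamma)\setminus C_\gamma\qquad\text{and}\qquad \mathcal{T}(\langle\gamma\rangle)=\mathcal{B}_\gamma .$$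
   Context: $\mathbb{E}$ is the affine space modeled on $\mathbb{R}^{2,1}=\mathbb{R}^3$ with the form $\mathbb{B}((x,y,z),(u,v,w))=xu+yv-zw$; once an origin is chosen, points are identified with vectors. A vector $v$ is timelike if $\mathbb{B}(v,v)<0$, lightlike (null) if $\mathbb{B}(v,v)=0$, spacelike if $\mathbb{B}(v,v)>0$. A timelike or nonzero lightlike vector is future directed if its third coordinate is positive. $\mathrm{Isom}(\mathbb{E})$ is the group of affine isometries $\gamma(p)=g(p)+v$, with linear part $g\in \mathrm{O}(2,1)$ and translational part $v\in\mathbb{R}^{2,1}$; only isometries preserving orientation and time-orientation (linear part in the identity component of $\mathrm{SO}(2,1)$) are considered. Such an isometry is hyperbolic if $\mathrm{tr}(g)>3$. For hyperbolic $\gamma$ with linear part $g$: $g$ has eigenvalues $\lambda<1<\lambda^{-1}$ with null future-directed eigenvectors $\mathsf{x}^-(g)$ (eigenvalue $\lambda$) and $\mathsf{x}^+(g)$ (eigenvalue $\lambda^{-1}$), normalized so that $\mathbb{B}(\mathsf{x}^-(g),\mathsf{x}^+(g))=-1$; $\mathsf{x}^o(g)$ is the $1$-eigenvector with $\mathbb{B}(\mathsf{x}^o(g),\mathsf{x}^o(g))=1$ such that $(\mathsf{x}^-(g),\mathsf{x}^+(g),\mathsf{x}^o(g))$ is right-handed. $C_\gamma$ is the unique $\gamma$-invariant line parallel to $\mathsf{x}^o(g)$; $\gamma$ has a fixed point if and only if $C_\gamma$ is pointwise fixed. Closed timelike curves: if $\Gamma$ acts on an open set $X\subset\mathbb{E}$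 so that every point of $X$ has a neighborhood $U$ with $\eta U\cap U=\emptyset$ for all $\eta\in\Gamma\setminus\{1\}$, then $X/\Gamma$ inherits a flat Lorentz structure; a timelike curve in $X/\Gamma$ is a $C^1$ path $c:[0,1]\to X/\Gamma$ all of whose tangent vectors are timelike, and it is closed if $c(0)=c(1)$. The CTC region of $X/\Gamma$ is the set of points lying on some closed timelike curve. $\mathcal{T}(\Gamma)$ is the set of $p\in X$ whose image $[p]$ lies in the CTC region of $X/\Gamma$, and $\mathcal{F}(\Gamma)=X\setminus\mathcal{T}(\Gamma)$. Here $\Gamma=\langle\gamma\rangle$ and $X=\mathbb{E}\setminus C_\gamma$. *)

(* Defs.v *)
From HB Require Import structures.
From mathcomp Require Import all_boot all_order all_algebra.
From mathcomp Require Import all_classical all_reals all_analysis.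

Set Implicit Arguments.
Unset Strict Implicit.
Unset Printing Implicit Defensive.

Import Order.TTheory GRing.Theory Num.Theory.
Import numFieldNormedType.Exports.

Local Open Scope classical_set_scope.
Local Open Scope ring_scope.

(** Minkowski space is ['cV[R]_3] with its usual topology; no point of it is
    singled out below, so the same type serves for the affine space and for its
    vectors. Linear maps act on columns on the left, [p |-> g *m p]. *)

Definition lorentz {R : realType} (v w : 'cV[R]_3) : R :=
  v 0 0 * w 0 0 + v 1 0 * w 1 0 - v 2 0 * w 2 0.

Definition timelike {R : realType} (v : 'cV[R]_3) : Prop := lorentz v v < 0.

Definition lightlike {R : realType} (v : 'cV[R]_3) : Prop := lorentz v v = 0.

Definition future_directed {R : realType} (v : 'cV[R]_3) : Prop :=
  (timelike v \/ (lightlike v /\ v <> 0)) /\ 0 < v 2 0.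

Definition in_O21 {R : realType} (g : 'M[R]_3) : Prop :=
  forall v w : 'cV[R]_3, lorentz (g *m v) (g *m w) = lorentz v w.

(** The identity component of SO(2,1): orientation and time-orientation are
    both preserved. *)
Definition in_SO21_0 {R : realType} (g : 'M[R]_3) : Prop :=
  [/\ in_O21 g, \det g = 1 &
      forall v : 'cV[R]_3, future_directed v -> future_directed (g *m v)].

Definition isometry_with_linear_part {R : realType}
    (gamma : 'cV[R]_3 -> 'cV[R]_3) (g : 'M[R]_3) : Prop :=
  in_SO21_0 g /\ exists v : 'cV[R]_3, forall p, gamma p = g *m p + v.

Definition hyperbolic {R : realType}
    (gamma : 'cV[R]_3 -> 'cV[R]_3) (g : 'M[R]_3) : Prop :=
  isometry_with_linear_part gamma g /\ 3 < \tr g.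

(** The vectors x^-(g), x^+(g), x^o(g). The normalization leaves the freedom
    of rescaling (x^-, x^+) to (a x^-, a^-1 x^+) with a > 0, hence a predicate
    rather than a function of g. *)
Definition null_frame {R : realType} (g : 'M[R]_3)
    (xm xp xo : 'cV[R]_3) : Prop :=
  (exists l : R, [/\ l < 1, 1 < l^-1, g *m xm = l *: xm
                   & g *m xp = l^-1 *: xp]) /\
  [/\ lightlike xm, future_directed xm, lightlike xp, future_directed xp
    & lorentz xm xp = -1] /\
  [/\ g *m xo = xo, lorentz xo xo = 1
    & 0 < \det (row_mx xm (row_mx xp xo) : 'M[R]_3)].

Definition invariant_line {R : realType} (gamma : 'cV[R]_3 -> 'cV[R]_3)
    (xo : 'cV[R]_3) (C : set 'cV[R]_3) : Prop :=
  (exists q : 'cV[R]_3, C = [set q + t *: xo | t in [set: R]]) /\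
  gamma @` C = C.

Definition cyclic_group {T : Type} (gamma : T -> T) : set (T -> T) :=
  [set eta | exists n : nat, eta = iter n gamma \/
     (cancel eta (iter n gamma) /\ cancel (iter n gamma) eta)].

(** A point of the quotient of X by Gamma is an orbit, i.e. a set of points. *)
Definition orbit_of {T : Type} (Gamma : set (T -> T)) (p : T) : set T :=
  [set eta p | eta in Gamma].

Definition orbit_space {T : Type} (Gamma : set (T -> T)) (X : set T) :
    set (set T) :=
  [set orbit_of Gamma p | p in X].

(** The sets U on which the projection to the quotient is injective, as in the
    covering condition; its inverses on such U are the charts of the flat
    Lorentz structure of the quotient. *)
Definition chart_domain {T : topologicalType} (Gamma : set (T -> T))
    (X U : set T) : Prop :=
  [/\ open U, U `<=` X &
      forall eta, Gamma eta -> eta <> id -> (eta @` U) `&` U = set0].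

Definition unit_itv (R : realType) : set R := `[0, 1]%classic.
Arguments unit_itv : clear implicits.

(** Derivative relative to [0,1], hence one-sided at the endpoints. *)
Definition has_velocity {R : realType} (f : R -> 'cV[R]_3) (t : R)
    (v : 'cV[R]_3) : Prop :=
  (fun s : R => (s - t)^-1 *: (f s - f t)) @ within (unit_itv R) t^' --> v.

(** Around each parameter t, the curve c read in some chart (U, as above) is a
    C^1 map f whose derivative f' is timelike. Only the values of c on [0,1]
    are relevant. *)
Definition timelike_curve {R : realType}
    (Gamma : set ('cV[R]_3 -> 'cV[R]_3)) (X : set 'cV[R]_3)
    (c : R -> set 'cV[R]_3) : Prop :=
  (forall t : R, unit_itv R t -> orbit_space Gamma X (c t)) /\
  (forall t : R, unit_itv R t ->
     exists (U : set 'cV[R]_3) (I : set R) (f f' : R -> 'cV[R]_3),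
       [/\ chart_domain Gamma X U, open I, I t,
           forall s : R, (unit_itv R `&` I) s ->
             [/\ U (f s), c s = orbit_of Gamma (f s),
                 has_velocity f s (f' s) & timelike (f' s)]
         & {within unit_itv R `&` I, continuous f'}]).

(** The tangents at the two ends need not match. *)
Definition closed_timelike_curve {R : realType}
    (Gamma : set ('cV[R]_3 -> 'cV[R]_3)) (X : set 'cV[R]_3)
    (c : R -> set 'cV[R]_3) : Prop :=
  timelike_curve Gamma X c /\ c 0 = c 1.

Definition CTC_region {R : realType}
    (Gamma : set ('cV[R]_3 -> 'cV[R]_3)) (X : set 'cV[R]_3) :
    set (set 'cV[R]_3) :=
  [set y | exists (c : R -> set 'cV[R]_3) (t : R),
     [/\ closed_timelike_curve Gamma X c, unit_itv R t & c t = y]].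

Definition CTC_points {R : realType}
    (Gamma : set ('cV[R]_3 -> 'cV[R]_3)) (X : set 'cV[R]_3) : set 'cV[R]_3 :=
  [set p | X p /\ CTC_region Gamma X (orbit_of Gamma p)].

Definition CTC_free_points {R : realType}
    (Gamma : set ('cV[R]_3 -> 'cV[R]_3)) (X : set 'cV[R]_3) : set 'cV[R]_3 :=
  X `\` CTC_points Gamma X.

Definition region_B {R : realType} (o xm xp xo : 'cV[R]_3) : set 'cV[R]_3 :=
  [set p | exists pm pp po : R,
     p = o + (pm *: xm + pp *: xp + po *: xo) /\ pm * pp < 0].

Definition region_Gplus {R : realType} (o xm xp xo : 'cV[R]_3) :
    set 'cV[R]_3 :=
  [set p | exists pm pp po : R,
     [/\ p = o + (pm *: xm + pp *: xp + po *: xo), 0 <= pm & 0 <= pp]].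

Definition region_Gminus {R : realType} (o xm xp xo : 'cV[R]_3) :
    set 'cV[R]_3 :=
  [set p | exists pm pp po : R,
     [/\ p = o + (pm *: xm + pp *: xp + po *: xo), pm <= 0 & pp <= 0]].

(* Main.v *)
Require Import Defs.
From HB Require Import structures.
From mathcomp Require Import all_boot all_order all_algebra.
From mathcomp Require Import all_classical all_reals all_analysis.
From mathcomp Require Import zify ring lra.

Set Implicit Arguments.
Unset Strict Implicit.
Unset Printing Implicit Defensive.

Import Order.TTheory GRing.Theory Num.Theory.
Import numFieldNormedType.Exports.

Local Open Scope classical_set_scope.
Local Open Scope ring_scope.

(** In the coordinates (m, p, o) of a point with respect to x^-, x^+, x^o the
    isometry is (m, p, o) |-> (l m, l^-1 p, o) with 0 < l < 1, and a vector is
    timelike only if its m- and p-components are nonzero of equal sign. When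
    m p < 0 the segment from a point to its image under gamma is therefore
    timelike, and it closes up in the quotient. Conversely, local lifts of a
    timelike curve differ by powers of gamma, which preserve the sign of
    dm/dt, so this sign is constant along the curve. Hence the invariant
    functions max(0, m) max(0, p) and max(0, -m) max(0, -p) are monotone along
    the curve, and constant if it is closed; but they vary strictly at points
    where m, p >= 0, respectively m, p <= 0. *)

(** * Local-to-global arguments on an interval *)

(** Supremum argument: the set of [x] with [P a x] reaches its supremum and, if that were below [b],
    would extend past it. The local hypothesis only compares points on opposite sides of [t], which
    is all that chaining through the supremum requires. *)
Lemma interval_chain (R : realType) (P : R -> R -> Prop) (a b : R) :
  a <= b ->
  (forall x y z, P x y -> P y z -> P x z) ->
  (forall t, a <= t <= b -> exists2 e, 0 < e &
     forall x y, a <= x -> x <= t -> t <= y -> y <= b ->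
       t - e < x -> y < t + e -> P x y) ->
  P a b.
Proof.
move=> leab Ptrans Ploc.
pose S := [set x | a <= x <= b /\ P a x].
have [e0 e0gt0 Pa] := Ploc a ltac:(by rewrite lexx leab).
have Sa : S a by split; [rewrite lexx leab | apply: Pa => //; lra].
have Sub : has_ubound S by exists b => x [/andP[]].
have Ssup : has_sup S by split => //; exists a.
have lea_sup : a <= sup S by apply: ub_le_sup.
have sup_leb : sup S <= b.
  by apply: ge_sup; [exists a | move=> x [/andP[]]].
have [e egt0 Pe] := Ploc (sup S) ltac:(by rewrite lea_sup sup_leb).
have [x [/andP[leax lexb] Pax] ltx] := sup_adherent egt0 Ssup.
have lexsup : x <= sup S by apply: ub_le_sup => //; split=> //; apply/andP.
have step y : sup S <= y -> y <= b -> y < sup S + e -> P a y.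
  by move=> *; apply: Ptrans Pax _; apply: Pe.
(* Either [b] is within reach of the supremum, or [sup S + e / 2] lies in [S], which is absurd. *)
have [ltsb|] := ltP b (sup S + e); first exact: step.
move=> leb; have : sup S + e / 2 <= sup S; last lra.
by apply: ub_le_sup => //; split; [lra | apply: step; lra].
Qed.

Lemma unit_itvE (R : realType) (t : R) : unit_itv R t = (0 <= t <= 1) :> Prop.
Proof. by rewrite /unit_itv set_itvE. Qed.

(** Comparing both neighbours with the value at [t] gives local monotonicity across [t]; chaining
    makes [h] nondecreasing on the whole interval, and equal end values leave no room to vary. *)
Lemma eq_constant_of_locally_nondecreasing (R : realType) (h : R -> R) :
  (forall t, unit_itv R t ->
     \forall s \near within (unit_itv R) t^', 0 <= (s - t) * (h s - h t)) ->
  h 0 = h 1 -> forall t, unit_itv R t -> h t = h 0.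
Proof.
move=> hloc h01 t.
have mono x y : 0 <= x -> x <= y -> y <= 1 -> h x <= h y.
  move=> x0 xy y1.
  apply: (@interval_chain R (fun u v => h u <= h v)) => //.
    by move=> u v w; apply: le_trans.
  move=> u /andP[xu uy].
  have /hloc : unit_itv R u by rewrite unit_itvE; lra.
  rewrite /dnbhs /within /= => /nbhs_ballP[e /= e0 He].
  exists e => // v w xv vu uw wy ev ew.
  have near_mono r : x <= r -> r <= y -> u - e < r -> r < u + e ->
      0 <= (r - u) * (h r - h u).
    move=> xr ry er re.
    have [->|ru] := eqVneq r u; first by rewrite subrr mul0r.
    apply: He => /=; [|by []|by rewrite unit_itvE; lra].
    by rewrite /ball /= ltr_norml; lra.
  apply: (@le_trans _ _ (h u)).
    have [vu'|uv|->//] := ltgtP v u; last by lra.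
    have : 0 <= (v - u) * (h v - h u) by apply: near_mono; lra.
    by rewrite nmulr_rge0 ?subr_le0 // subr_lt0.
  have [wu'|uw'|->//] := ltgtP w u; first by lra.
  have : 0 <= (w - u) * (h w - h u) by apply: near_mono; lra.
  by rewrite pmulr_rge0 ?subr_ge0 // subr_gt0.
rewrite unit_itvE => /andP[t0 t1].
by apply/eqP; rewrite eq_le {1}h01 !mono.
Qed.

(** Chooses the side of [t] on which to evaluate a local property; at an endpoint of the interval
    only one value of [d] is possible. *)
Lemma punctured_near_pick (R : realType) (P : R -> Prop) (t d : R) :
  unit_itv R t -> (d = 1 /\ t < 1) \/ (d = -1 /\ 0 < t) ->
  (\forall s \near within (unit_itv R) t^', P s) ->
  exists s, [/\ unit_itv R s, 0 < d * (s - t) & P s].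
Proof.
rewrite unit_itvE => /andP[t0 t1] dt; rewrite /dnbhs /within /=.
move=> /nbhs_ballP[e /= e0 eP].
suff [s [s01 ds se]] : exists s,
    [/\ 0 <= s <= 1, 0 < d * (s - t) & `|t - s| < e].
  exists s; rewrite unit_itvE; split=> //; apply: (eP s se).
    by apply: contraTneq ds => ->; rewrite subrr mulr0 ltxx.
  by rewrite unit_itvE.
case: dt => -[-> tb].
  have [et|et] := leP e (1 - t).
    by exists (t + e / 2); split; [lra|lra|rewrite ltr_norml; lra].
  by exists ((1 + t) / 2); split; [lra|lra|rewrite ltr_norml; lra].
have [et|et] := leP e t.
  by exists (t - e / 2); split; [lra|lra|rewrite ltr_norml; lra].
by exists (t / 2); split; [lra|lra|rewrite ltr_norml; lra].
Qed.

(** * The Lorentz form and first-order behaviour of curves *)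

Lemma lorentzC (R : realType) (v w : 'cV[R]_3) : lorentz v w = lorentz w v.
Proof. by rewrite /lorentz; ring. Qed.

Lemma lorentzDl (R : realType) (u v w : 'cV[R]_3) :
  lorentz (u + v) w = lorentz u w + lorentz v w.
Proof. by rewrite /lorentz !mxE; ring. Qed.

Lemma lorentzZl (R : realType) (a : R) (v w : 'cV[R]_3) :
  lorentz (a *: v) w = a * lorentz v w.
Proof. by rewrite /lorentz !mxE; ring. Qed.

Lemma lorentzBl (R : realType) (u v w : 'cV[R]_3) :
  lorentz (u - v) w = lorentz u w - lorentz v w.
Proof. by rewrite lorentzDl -scaleN1r lorentzZl mulN1r. Qed.

Lemma lorentzZr (R : realType) (a : R) (v w : 'cV[R]_3) :
  lorentz v (a *: w) = a * lorentz v w.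
Proof. by rewrite lorentzC lorentzZl lorentzC. Qed.

Lemma lorentz_continuous (R : realType) (w : 'cV[R]_3) :
  continuous (fun v => lorentz v w).
Proof.
move=> v.
have c i : (fun u : 'cV[R]_3 => u i 0 * w i 0) @ v --> v i 0 * w i 0.
  exact: (cvgM (@coord_continuous R 3 1 i 0 v) (cvg_cst (w i 0))).
exact: cvgB (cvgD (c 0) (c 1)) (c 2).
Qed.

Lemma near_within_neq (R : realType) (D : set R) (t : R) :
  \forall s \near within D t^', s != t.
Proof. exact: (@filterE _ (nbhs t) _ _ (fun s st _ => st)). Qed.

Lemma has_velocity_continuous (R : realType) (f : R -> 'cV[R]_3) (t : R) v :
  has_velocity f t v -> f @ within (unit_itv R) t^' --> f t.
Proof.
move=> fv.
have FW : Filter (within (unit_itv R) t^') by exact: within_filter.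
have tt : (fun s : R => s - t) @ within (unit_itv R) t^' --> (0 : R).
  rewrite -(subrr t); apply: cvgB; last exact: cvg_cst.
  apply: (@cvg_trans _ (nbhs t)) => // A At.
  by apply: cvg_within; apply: nbhs_dnbhs.
have := cvgZ (FF := FW) tt fv; rewrite scale0r => ft0.
have ft : f t + (s - t) *: ((s - t)^-1 *: (f s - f t))
    @[s --> within (unit_itv R) t^'] --> f t.
  by rewrite -[X in _ --> X]addr0; apply: (cvgD (FF := FW)) ft0; exact: cvg_cst.
move=> A /ft; rewrite /= /nbhs /= => fA.
apply: filterS2 fA (near_within_neq (unit_itv R) t) => s /= + st.
by rewrite scalerA divff ?subr_eq0 // scale1r addrC subrK.
Qed.

Lemma has_velocity_sign (R : realType) (f : R -> 'cV[R]_3) (t e : R) v w :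
  has_velocity f t v -> 0 < e * lorentz v w ->
  \forall s \near within (unit_itv R) t^',
    0 < e * (s - t) * lorentz (f s - f t) w.
Proof.
move=> fv vgt0.
have lv := cvg_comp _ _ fv (@lorentz_continuous R w v).
have : (fun s => e * lorentz ((s - t)^-1 *: (f s - f t)) w) @
         within (unit_itv R) t^' --> e * lorentz v w.
  by apply: cvgM; [exact: cvg_cst | exact: lv].
move=> /(_ _ (lt_nbhsr vgt0)); rewrite /= /nbhs /= => fpos.
have FW : Filter (within (unit_itv R) t^') by exact: within_filter.
apply: filterS2 fpos (near_within_neq (unit_itv R) t) => s /= + st.
rewrite lorentzZl => pos.
(* The factor [(s - t) ^+ 2] turns the difference quotient into the increment times [s - t], with
   the same sign on both sides of [t]. *)
have -> : e * (s - t) * lorentz (f s - f t) w =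
  (s - t) ^+ 2 * (e * ((s - t)^-1 * lorentz (f s - f t) w)).
  by field; rewrite subr_eq0.
by rewrite pmulr_rgt0 // exprn_even_gt0 // subr_eq0.
Qed.

(** * Null bases *)

Record null_basis (R : realType) (xm xp xo : 'cV[R]_3) : Prop := NullBasis {
  nb_mm : lorentz xm xm = 0;
  nb_pp : lorentz xp xp = 0;
  nb_oo : lorentz xo xo = 1;
  nb_mp : lorentz xm xp = -1;
  nb_mo : lorentz xm xo = 0;
  nb_po : lorentz xp xo = 0;
  nb_span : forall v, v = (- lorentz v xp) *: xm + (- lorentz v xm) *: xp
                          + lorentz v xo *: xo
}.

Lemma null_frame_ratio (R : realType) (g : 'M[R]_3) (xm xp xo : 'cV[R]_3) :
  null_frame g xm xp xo ->
  exists2 l : R, 0 < l < 1 & g *m xm = l *: xm /\ g *m xp = l^-1 *: xp.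
Proof.
move=> [[l [l1 ? ? ?]] _]; exists l => //; rewrite l1 andbT.
by rewrite -invr_gt0; lra.
Qed.

(** Eigenvectors of an isometry are orthogonal unless their eigenvalues multiply to 1, so [xo] is
    orthogonal to [xm] and [xp]. The determinant gives spanning, and pairing with the frame
    identifies the coefficients. *)
Lemma null_frame_null_basis (R : realType) (g : 'M[R]_3)
    (xm xp xo : 'cV[R]_3) :
  in_O21 g -> null_frame g xm xp xo -> null_basis xm xp xo.
Proof.
move=> gO frame.
have [l /andP[l0 l1] [gm gp]] := null_frame_ratio frame.
case: frame => _ [[mm _ pp _ mp] [go oo det0]].
have mo : lorentz xm xo = 0.
  have := gO xm xo; rewrite gm go lorentzZl => /eqP.
  rewrite -subr_eq0 -[X in _ - X]mul1r -mulrBl mulf_eq0 subr_eq0.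
  by rewrite lt_eqF //= => /eqP.
have po : lorentz xp xo = 0.
  have := gO xp xo; rewrite gp go lorentzZl => /eqP.
  rewrite -subr_eq0 -[X in _ - X]mul1r -mulrBl mulf_eq0 subr_eq0.
  by rewrite gt_eqF ?invf_gt1 //= => /eqP.
split => // v.
pose M : 'M[R]_(1 + (1 + 1)) := row_mx xm (row_mx xp xo).
have Mu : M \in unitmx by rewrite unitmxE unitfE gt_eqF.
pose w : 'cV[R]_(1 + (1 + 1)) := invmx M *m v.
have [a [b [c vE]]] : exists a b c : R, v = a *: xm + b *: xp + c *: xo.
  exists (usubmx w 0 0), (usubmx (dsubmx w) 0 0), (dsubmx (dsubmx w) 0 0).
  rewrite -[LHS](mulKVmx Mu) -/w -[w in LHS]vsubmxK.
  rewrite -[dsubmx w in LHS]vsubmxK !mul_row_col.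
  rewrite [usubmx w in LHS]mx11_scalar [usubmx (dsubmx w) in LHS]mx11_scalar.
  by rewrite [dsubmx (dsubmx w) in LHS]mx11_scalar !mul_mx_scalar addrA.
rewrite {2 3 4}vE !lorentzDl !lorentzZl mm pp oo mp mo po.
rewrite (lorentzC xp xm) mp !(lorentzC xo) mo po vE.
by congr (_ *: _ + _ *: _ + _ *: _); ring.
Qed.

(** * Null coordinates and boosts *)

Section Boosts.
Variables (R : realType) (xm xp xo o : 'cV[R]_3) (l : R).
Hypothesis basis : null_basis xm xp xo.
Hypothesis l_gt0 : 0 < l.
Hypothesis l_lt1 : l < 1.

(** Coordinates by duality: [xm] and [xp] are null with product -1, so the component along one is
    minus the pairing with the other. *)
Definition mcoord (p : 'cV[R]_3) : R := - lorentz (p - o) xp.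
Definition pcoord (p : 'cV[R]_3) : R := - lorentz (p - o) xm.
Definition ocoord (p : 'cV[R]_3) : R := lorentz (p - o) xo.

Definition frame_point (a b c : R) : 'cV[R]_3 :=
  o + (a *: xm + b *: xp + c *: xo).

(** The [k]-th power of gamma in coordinates; an integer exponent treats iterates and their inverses
    uniformly. *)
Definition boost (k : int) (p : 'cV[R]_3) : 'cV[R]_3 :=
  frame_point (l ^ k * mcoord p) (l ^ (- k) * pcoord p) (ocoord p).

Lemma frame_pointK p : frame_point (mcoord p) (pcoord p) (ocoord p) = p.
Proof. by rewrite /frame_point -(nb_span basis) addrC subrK. Qed.

Lemma mcoord_frame_point a b c : mcoord (frame_point a b c) = a.
Proof.
rewrite /mcoord /frame_point addrC addKr !lorentzDl !lorentzZl (lorentzC xo).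
by rewrite (nb_mp basis) (nb_pp basis) (nb_po basis); ring.
Qed.

Lemma pcoord_frame_point a b c : pcoord (frame_point a b c) = b.
Proof.
rewrite /pcoord /frame_point addrC addKr !lorentzDl !lorentzZl.
rewrite (lorentzC xo) (lorentzC xp).
by rewrite (nb_mp basis) (nb_mm basis) (nb_mo basis); ring.
Qed.

Lemma ocoord_frame_point a b c : ocoord (frame_point a b c) = c.
Proof.
rewrite /ocoord /frame_point addrC addKr !lorentzDl !lorentzZl.
by rewrite (nb_mo basis) (nb_po basis) (nb_oo basis); ring.
Qed.

Lemma mcoord_boost k p : mcoord (boost k p) = l ^ k * mcoord p.
Proof. exact: mcoord_frame_point. Qed.

Lemma pcoord_boost k p : pcoord (boost k p) = l ^ (- k) * pcoord p.
Proof. exact: pcoord_frame_point. Qed.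

Lemma ocoord_boost k p : ocoord (boost k p) = ocoord p.
Proof. exact: ocoord_frame_point. Qed.

Lemma boostD j k p : boost j (boost k p) = boost (j + k) p.
Proof.
have lN0 : l != 0 by rewrite gt_eqF.
rewrite {1}/boost mcoord_boost pcoord_boost ocoord_boost.
by rewrite !mulrA -!expfzDr // -opprD.
Qed.

Lemma boost0 p : boost 0 p = p.
Proof. by rewrite /boost oppr0 !expr0z !mul1r frame_pointK. Qed.

Lemma boost_cancel k : cancel (boost k) (boost (- k)).
Proof. by move=> p; rewrite boostD addNr boost0. Qed.

(** In components this is [o^2 - 2 m p], so a timelike vector has [m p > 0], and [m p > 0] suffices
    when [o = 0]. *)
Lemma lorentz_sqr v :
  lorentz v v = lorentz v xo ^+ 2 - 2 * lorentz v xp * lorentz v xm.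
Proof.
rewrite {1}[v](nb_span basis) !lorentzDl !lorentzZl.
by rewrite (lorentzC xm) (lorentzC xp) (lorentzC xo); ring.
Qed.

Lemma mcoordB p q : mcoord p - mcoord q = - lorentz (p - q) xp.
Proof. by rewrite /mcoord !lorentzBl; ring. Qed.

Lemma pcoordB p q : pcoord p - pcoord q = - lorentz (p - q) xm.
Proof. by rewrite /pcoord !lorentzBl; ring. Qed.

Lemma lorentz_from_continuous w :
  continuous (fun p : 'cV[R]_3 => lorentz (p - o) w).
Proof.
move=> p; apply: (@cvg_comp _ _ _ (fun q => q - o) (fun v => lorentz v w)
  (nbhs p) (nbhs (p - o))); last exact: lorentz_continuous.
by apply: (@cvgB _ _ _ (nbhs p)); [exact: cvg_id | exact: cvg_cst].
Qed.

Lemma mcoord_continuous : continuous mcoord.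
Proof. by move=> p; exact: (cvgN (@lorentz_from_continuous xp p)). Qed.

Lemma pcoord_continuous : continuous pcoord.
Proof. by move=> p; exact: (cvgN (@lorentz_from_continuous xm p)). Qed.

Lemma boost_continuous k : continuous (boost k).
Proof.
move=> p.
have nF : Filter (nbhs p) by exact: nbhs_filter.
have mc := cvgMl_tmp (FF := nF) (a := l ^ k) (@mcoord_continuous p).
have pc := cvgMl_tmp (FF := nF) (a := l ^ (- k)) (@pcoord_continuous p).
have oc := @lorentz_from_continuous xo p.
exact: (cvgD (FF := nF) (cvg_cst o) (cvgD (FF := nF)
  (cvgD (FF := nF) (cvgZr_tmp (FF := nF) mc) (cvgZr_tmp (FF := nF) pc))
  (cvgZr_tmp (FF := nF) oc))).
Qed.

(** * The cyclic group, its orbits and charts *)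

Variables (gamma : 'cV[R]_3 -> 'cV[R]_3) (C : set 'cV[R]_3).
Hypothesis gammaE : forall p, gamma p = boost 1 p.
Hypothesis CE : forall p, C p <-> mcoord p = 0 /\ pcoord p = 0.

Lemma iter_boost n p : iter n gamma p = boost n p.
Proof.
by elim: n => [|n /= ->]; [rewrite boost0 | rewrite gammaE boostD -intS].
Qed.

Lemma cyclic_group_boost eta :
  cyclic_group gamma eta <-> exists k, eta = boost k.
Proof.
split=> [[n [->|[etaK Keta]]]|[[n|n] ->]].
- by exists n; apply/funext => p; exact: iter_boost.
- exists (- n%:Z); apply/funext => p.
  by rewrite -{2}[p]etaK iter_boost boost_cancel.
- by exists n; left; apply/funext => p; rewrite iter_boost.
(* [Negz n] stands for [-(n + 1)], hence the inverse of the iterate of order [n.+1]. *)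
- exists n.+1; right; split=> p; rewrite iter_boost NegzE.
    by rewrite boostD subrr boost0.
  by rewrite boost_cancel.
Qed.

Lemma mem_orbit p q :
  orbit_of (cyclic_group gamma) p q <-> exists k, q = boost k p.
Proof.
split=> [[eta /cyclic_group_boost[k ->] <-]|[k ->]]; first by exists k.
by exists (boost k) => //; apply/cyclic_group_boost; exists k.
Qed.

Lemma orbit_refl p : orbit_of (cyclic_group gamma) p p.
Proof. by apply/mem_orbit; exists 0; rewrite boost0. Qed.

Lemma orbit_boost k p :
  orbit_of (cyclic_group gamma) (boost k p) = orbit_of (cyclic_group gamma) p.
Proof.
apply/seteqP; split=> q /mem_orbit[j ->]; apply/mem_orbit.
  by exists (j + k); rewrite boostD.
by exists (j - k); rewrite boostD subrK.
Qed.

Lemma orbit_eq p q :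
  orbit_of (cyclic_group gamma) p = orbit_of (cyclic_group gamma) q ->
  exists k, q = boost k p.
Proof. by move=> pq; apply/mem_orbit; rewrite pq; exact: orbit_refl. Qed.

Lemma chart_domain_boost X U k p :
  chart_domain (cyclic_group gamma) X U -> U p -> U (boost k p) ->
  boost k p = p.
Proof.
move=> [_ _ disj] Up Ukp; have [->//|kid] := pselect (boost k = id).
have : (boost k @` U `&` U) (boost k p) by split=> //; exists p.
by rewrite disj //; apply/cyclic_group_boost; exists k.
Qed.

(** The bounds have ratio exactly [l], so the slab is disjoint from its translates by nontrivial
    powers; they enclose 1, so the slab contains every point whose m-coordinate is [a]. *)
Lemma mcoord_chart_domain (a : R) : a != 0 ->
  chart_domain (cyclic_group gamma) (~` C)
    [set x | 2 * l / (1 + l) < mcoord x / a < 2 / (1 + l)].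
Proof.
move=> a0; have l1 : 0 < 1 + l by rewrite addr_gt0.
split.
- have -> : [set x | 2 * l / (1 + l) < mcoord x / a < 2 / (1 + l)] =
    (fun x => mcoord x / a) @^-1` `]2 * l / (1 + l), 2 / (1 + l)[%classic.
    by rewrite set_itvE.
  apply: open_comp; last exact: itv_open.
  move=> x _.
  exact: (cvgMr_tmp (FF := nbhs_filter x) (@mcoord_continuous x)).
- move=> x /= /andP[xl _] /CE[mx _]; move: xl; rewrite mx mul0r.
  by rewrite ltNge divr_ge0 ?mulr_ge0 // ltW.
move=> eta /cyclic_group_boost[k ->] kid.
apply/seteqP; split=> // _ [[x Ux <-]].
move: Ux => /= /andP[]; rewrite mcoord_boost -(mulrA (l ^ k)).
set r := mcoord x / a => rl ru /andP[krl kru].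
have r0 : 0 < r by apply: (lt_trans _ rl); rewrite divr_gt0 // mulr_gt0.
have lr : 2 * l / (1 + l) = l * (2 / (1 + l)) by ring.
apply: kid; apply/funext => p; suff -> : k = 0 by rewrite boost0.
(* Two values in the slab differ by a factor strictly between [l] and [l^-1], which leaves only the
   exponent 0. *)
have kl : l < l ^ k.
  rewrite -(ltr_pM2r r0); apply: (lt_trans _ krl).
  by rewrite lr ltr_pM2l.
have lk : l ^ k < l^-1.
  rewrite -(ltr_pM2r r0); apply: (lt_trans kru).
  by rewrite ltr_pdivlMl // -lr.
have Vl : 1 < l^-1 by rewrite invf_gt1.
have lkE : l ^ k = l^-1 ^ (- k) by rewrite exprz_inv opprK.
have k1 : -1 < - k by rewrite -(ltr_eXz2l Vl) -lkE exprz_inv.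
have k2 : - k < 1 by rewrite -(ltr_eXz2l Vl) -lkE exprz_inv.
by lia.
Qed.

(** * Closed timelike curves from segments *)

Lemma segment_mcoord p s :
  mcoord (p + s *: (gamma p - p)) = (1 + s * (l - 1)) * mcoord p.
Proof.
have := mcoordB (gamma p) p; rewrite gammaE mcoord_boost expr1z => wE.
have := mcoordB (p + s *: (boost 1 p - p)) p.
rewrite (addrC p) addrK lorentzZl -mulrN -wE => /eqP.
by rewrite subr_eq => /eqP ->; ring.
Qed.

(** The displacement has components [(l - 1) m], [(l^-1 - 1) p] and 0; the two factors have opposite
    signs, so [m p < 0] makes the null components agree in sign. *)
Lemma segment_timelike p :
  mcoord p * pcoord p < 0 -> timelike (gamma p - p).
Proof.
move=> mp0; rewrite /timelike lorentz_sqr.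
have := mcoordB (gamma p) p; have := pcoordB (gamma p) p.
have -> : lorentz (gamma p - p) xo = ocoord (gamma p) - ocoord p.
  by rewrite /ocoord !lorentzBl; ring.
rewrite gammaE mcoord_boost pcoord_boost ocoord_boost expr1z subrr.
move=> pE mE.
have {pE} -> : lorentz (boost 1 p - p) xm = - ((l^-1 - 1) * pcoord p).
  by rewrite mulrBl mul1r pE opprK.
have {mE} -> : lorentz (boost 1 p - p) xp = - ((l - 1) * mcoord p).
  by rewrite mulrBl mul1r mE opprK.
have -> : 0 ^+ 2 - 2 * - ((l - 1) * mcoord p) * - ((l^-1 - 1) * pcoord p) =
  (2 * (1 - l) * (l^-1 - 1)) * (mcoord p * pcoord p) by ring.
have Vl : 1 < l^-1 by rewrite invf_gt1.
by rewrite pmulr_rlt0 // !mulr_gt0 // subr_gt0.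
Qed.

Lemma has_velocity_affine (p w : 'cV[R]_3) t :
  has_velocity (fun s => p + s *: w) t w.
Proof.
have FW : Filter (within (unit_itv R) t^') by exact: within_filter.
have H : \forall s \near within (unit_itv R) t^',
    (s - t)^-1 *: (p + s *: w - (p + t *: w)) = w.
  apply: (@filterE _ (nbhs t)) => s st _.
  rewrite opprD addrACA subrr add0r -scalerBl scalerA mulVf ?scale1r //.
  by rewrite subr_eq0.
move=> A /nbhs_singleton Aw; rewrite /= /nbhs /=.
by apply: filterS H => s /= ->.
Qed.

Lemma segment_CTC p : mcoord p * pcoord p < 0 ->
  CTC_points (cyclic_group gamma) (~` C) p.
Proof.
move=> mp0; have m0 : mcoord p != 0.
  by apply: contraTneq mp0 => ->; rewrite mul0r ltxx.
have ms0 s : unit_itv R s -> mcoord (p + s *: (gamma p - p)) != 0.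
  rewrite unit_itvE segment_mcoord => /andP[s0 s1].
  (* The factor [1 + s * (l - 1)] equals [l + (1 - s) * (1 - l)], hence is positive: the segment
     never meets [C]. *)
  have : 0 <= (1 - s) * (1 - l) by rewrite mulr_ge0 // subr_ge0 // ltW.
  by move: l_gt0 => l0 sl; rewrite mulf_neq0 // gt_eqF //; lra.
have offC q : mcoord q != 0 -> (~` C) q.
  by move=> q0 /CE[/eqP]; rewrite (negbTE q0).
pose f s := p + s *: (gamma p - p).
have f0 : f 0 = p by rewrite /f scale0r addr0.
have f1 : f 1 = boost 1 p by rewrite /f scale1r addrC subrK gammaE.
split; first exact: offC.
exists (fun s => orbit_of (cyclic_group gamma) (f s)), 0; split; last 2 first.
- by rewrite unit_itvE lexx ler01.
- by rewrite f0.
split; last by rewrite f0 f1 orbit_boost.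
split=> t It; first by exists (f t) => //; apply/offC/ms0.
(* The chart is the slab normalized at the m-coordinate of [f t]. *)
set U := [set x | 2 * l / (1 + l) < mcoord x / mcoord (f t) < 2 / (1 + l)].
have Uc := mcoord_chart_domain (ms0 _ It); rewrite -/(f t) -/U in Uc.
have fc : continuous f.
  move=> s; apply: (@cvgD _ _ _ (nbhs s) _ (cst p)); first exact: cvg_cst.
  exact: (cvgZr_tmp (FF := nbhs_filter s) (@cvg_id _ (nbhs s))).
exists U, (f @^-1` U), f, (fun=> gamma p - p); split=> //.
- by apply: open_comp => //; case: Uc.
- have l1 : 0 < 1 + l by rewrite addr_gt0.
  rewrite /U /= divff ?ms0 // ltr_pdivrMr // ltr_pdivlMr //.
  by move: l_lt1 => l_lt1'; apply/andP; split; lra.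
- move=> s [Is Us]; split=> //; first exact: has_velocity_affine.
  exact: segment_timelike.
by apply: continuous_subspaceT => s; exact: cvg_cst.
Qed.

(** * Constancy of the time direction along a curve *)

(* [e] is the sign of the x^- component [- lorentz (f' t) xp] of the velocity;
   that of the x^+ component is the same since [f' t] is timelike. *)
Definition heading (c : R -> set 'cV[R]_3) (e t : R) : Prop :=
  exists (U : set 'cV[R]_3) (I : set R) (f f' : R -> 'cV[R]_3),
    [/\ chart_domain (cyclic_group gamma) (~` C) U, open I, I t,
        forall s : R, (unit_itv R `&` I) s ->
          [/\ U (f s), c s = orbit_of (cyclic_group gamma) (f s),
              has_velocity f s (f' s) & timelike (f' s)]
      & {within unit_itv R `&` I, continuous f'}] /\
    0 < e * - lorentz (f' t) xp.

Lemma timelike_coords v : timelike v -> 0 < lorentz v xp * lorentz v xm.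
Proof.
rewrite /timelike lorentz_sqr => v0.
have := sqr_ge0 (lorentz v xo); lra.
Qed.

Lemma heading_exists c t :
  timelike_curve (cyclic_group gamma) (~` C) c -> unit_itv R t ->
  heading c 1 t \/ heading c (-1) t.
Proof.
move=> [_ /(_ t) chart] It.
have [U [I [f [f' [Uc Io It' fI f'c]]]]] := chart It.
have [_ _ _ /timelike_coords v0] := fI t (conj It It').
have [neg|pos|eq0] := ltgtP (lorentz (f' t) xp) 0.
- by left; exists U, I, f, f'; split=> //; rewrite mul1r oppr_gt0.
- by right; exists U, I, f, f'; split=> //; rewrite mulrNN mul1r.
- by move: v0; rewrite eq0 mul0r ltxx.
Qed.

Lemma heading_lift c e t : unit_itv R t -> heading c e t ->
  exists (U : set 'cV[R]_3) (f : R -> 'cV[R]_3),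
  [/\ chart_domain (cyclic_group gamma) (~` C) U, U (f t),
      c t = orbit_of (cyclic_group gamma) (f t),
      f @ within (unit_itv R) t^' --> f t
    & \forall s \near within (unit_itv R) t^',
        [/\ U (f s), c s = orbit_of (cyclic_group gamma) (f s),
            0 < e * (s - t) * (mcoord (f s) - mcoord (f t))
          & 0 < e * (s - t) * (pcoord (f s) - pcoord (f t))]].
Proof.
move=> It [U [I [f [f' [[Uc Io It' fI f'c] e0]]]]]; exists U, f.
have [Uft ct ft /timelike_coords v0] := fI t (conj It It').
split=> //; first exact: has_velocity_continuous ft.
have FW : Filter (within (unit_itv R) t^') by exact: within_filter.
have In : \forall s \near within (unit_itv R) t^', I s.
  apply: cvg_within; apply: nbhs_dnbhs; exact: open_nbhs_nbhs.
have uI : \forall s \near within (unit_itv R) t^', unit_itv R s.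
  exact: (@filterE _ (nbhs t) _ _ (fun s _ Is => Is)).
have mp : 0 < - e * lorentz (f' t) xp by rewrite mulNr -mulrN.
have pp : 0 < - e * lorentz (f' t) xm.
  (* Multiplying by the positive quantity of [mp] leaves [(- e)^2] times the product that is
     positive for a timelike velocity. *)
  rewrite -(pmulr_rgt0 _ mp) mulrACA pmulr_rgt0 //.
  have eN0 : e != 0 by apply: contraTneq e0 => ->; rewrite mul0r ltxx.
  by rewrite -expr2 exprn_even_gt0 //= oppr_eq0.
have mn := has_velocity_sign ft mp; have pn := has_velocity_sign ft pp.
apply: filterS3 (filterI In uI) mn pn => s [Is us] ms ps.
have [Ufs cs _ _] := fI s (conj us Is); split=> //.
  by rewrite mcoordB mulrN -!mulNr.
by rewrite pcoordB mulrN -!mulNr.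
Qed.

(** Openness: by continuity of [f'] the same chart and lift still witness the sign nearby. *)
Lemma heading_near c e t : unit_itv R t -> heading c e t ->
  \forall s \near within (unit_itv R) (nbhs t), heading c e s.
Proof.
move=> It [U [I [f [f' [[Uc Io It' fI f'c] e0]]]]].
have f't := (subspace_continuousP _ _).1 f'c t (conj It It').
have FW := within_filter (unit_itv R `&` I) (nbhs_filter t).
have lc := cvgMl_tmp (FF := FW) (a := e)
  (cvgN (FF := FW) (cvg_comp _ _ f't (@lorentz_continuous R xp (f' t)))).
have := lc _ (lt_nbhsr e0); rewrite /= /nbhs /= => pos.
have In : \forall s \near nbhs t, I s by exact: open_nbhs_nbhs.
apply: (@filterS2 _ (nbhs t) _ _ _ _ _ In pos) => s /= Is ps us.
by exists U, I, f, f'; split=> //; exact: (ps (conj us Is)).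
Qed.

(** Two lifts at [t] differ by one boost, the same for all nearby parameters. It scales m-increments
    by [l ^ k > 0], so they cannot have opposite signs. *)
Lemma heading_unique c t : unit_itv R t ->
  heading c 1 t -> heading c (-1) t -> False.
Proof.
move=> It h1 h2.
have [U [f [_ _ ct fc fn]]] := heading_lift It h1.
have [V [g [Vc Vgt ct' _ gn]]] := heading_lift It h2.
have FW : Filter (within (unit_itv R) t^') by exact: within_filter.
have [k gft] : exists k, g t = boost k (f t) by apply: orbit_eq; rewrite -ct.
have Vn : \forall s \near within (unit_itv R) t^', V (boost k (f s)).
  have Vo : nbhs (boost k (f t)) V.
    by apply: open_nbhs_nbhs; split; [case: Vc | rewrite -gft].
  exact: (cvg_comp _ _ fc (@boost_continuous k (f t))) Vo.
have : \forall s \near within (unit_itv R) t^',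
    0 < 1 * (s - t) * (mcoord (f s) - mcoord (f t)) /\
    0 < -1 * (s - t) * (l ^ k * (mcoord (f s) - mcoord (f t))).
  apply: filterS3 fn gn Vn => s [_ cs ms _] [Vgs cs' ms' _] Vs; split=> //.
  (* Both [g s] and [boost k (f s)] lie in [V], which meets an orbit at most
     once. *)
  have [j gfs] : exists j, g s = boost j (boost k (f s)).
    by apply: orbit_eq; rewrite orbit_boost -cs.
  have : g s = boost k (f s).
    by rewrite gfs; apply: chart_domain_boost Vc _ _ => //; rewrite -gfs.
  by move: ms'; rewrite gft => + gsE; rewrite gsE !mcoord_boost -mulrBr.
(* Evaluate to the right of [t] if possible, otherwise to the left. *)
have [t1|t1] := ltP t 1.
  move=> /(punctured_near_pick It (d := 1)) [|s [_ _ []]]; first by left.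
  rewrite mulrCA mulN1r mulNr mul1r => pos.
  by rewrite pmulr_rgt0 ?exprz_gt0 // oppr_gt0 ltNge ltW.
move=> /(punctured_near_pick It (d := -1)) [|s [_ _ []]].
  by right; split=> //; lra.
rewrite mulrCA mulN1r mulNr mul1r => pos.
by rewrite pmulr_rgt0 ?exprz_gt0 // oppr_gt0 ltNge ltW.
Qed.

Lemma heading_sign_eq c e e' t : unit_itv R t -> e = 1 \/ e = -1 ->
  e' = 1 \/ e' = -1 -> heading c e t -> heading c e' t -> e = e'.
Proof.
by move=> It [] -> [] -> // h h'; case: (@heading_unique c t).
Qed.

(** Connectedness of the interval: the sign at 0 propagates because headings are locally constant
    and unique. *)
Lemma heading_constant c : timelike_curve (cyclic_group gamma) (~` C) c ->
  exists2 e, e = 1 \/ e = -1 & forall t, unit_itv R t -> heading c e t.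
Proof.
move=> cc.
have hex t : unit_itv R t -> exists2 e, e = 1 \/ e = -1 & heading c e t.
  by move=> /(heading_exists cc)[]; [exists 1 | exists (-1)]; auto.
have [|e eE he] := hex 0; first by rewrite unit_itvE lexx ler01.
exists e => // t; rewrite unit_itvE => /andP[t0 t1].
apply: (@interval_chain R
  (fun u v => heading c e u -> heading c e v) 0 t) => //.
  by move=> x y z xy yz /xy.
move=> u /andP[u0 ut]; have Iu : unit_itv R u by rewrite unit_itvE; lra.
have [e' e'E he'] := hex u Iu.
have := heading_near Iu he'; rewrite /within /= => /nbhs_ballP[r /= r0 hr].
exists r => // x y x0 xu uy yt rx ry hx.
have near_u z : 0 <= z -> z <= 1 -> u - r < z -> z < u + r -> heading c e' z.
  move=> z0 z1 rz zr; apply: (hr z); last by rewrite unit_itvE z0.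
  by rewrite /ball /= ltr_norml; lra.
have Ix : unit_itv R x by rewrite unit_itvE; lra.
(* At [x] the curve has both the transported sign [e] and the sign [e'] valid near [u]. *)
have -> : e = e'.
  by apply: (heading_sign_eq Ix eE e'E hx); apply: near_u; lra.
by apply: near_u; lra.
Qed.

(** * Invariant functions monotone along timelike curves *)

(** The product [m p] is invariant but not monotone in each coordinate; truncating to one quadrant
    makes it so. *)
Definition quadrant_product (e : R) (p : 'cV[R]_3) : R :=
  Num.max 0 (e * mcoord p) * Num.max 0 (e * pcoord p).

Lemma quadrant_product_boost e k p :
  quadrant_product e (boost k p) = quadrant_product e p.
Proof.
have lk j : 0 <= l ^ j by rewrite ltW // exprz_gt0.
rewrite /quadrant_product mcoord_boost pcoord_boost 2!(mulrCA e).
have maxM j x : Num.max 0 (l ^ j * x) = l ^ j * Num.max 0 x.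
  by rewrite maxr_pMr // mulr0.
rewrite !maxM.
by rewrite mulrACA -expfzDr ?gt_eqF // subrr expr0z mul1r.
Qed.

Lemma quadrant_product_le e p q :
  0 <= e * (mcoord q - mcoord p) -> 0 <= e * (pcoord q - pcoord p) ->
  quadrant_product e p <= quadrant_product e q.
Proof.
rewrite !mulrBr !subr_ge0 => mpq ppq.
have max_ge0 (x : R) : 0 <= Num.max 0 x by rewrite le_max lexx.
by apply: ler_pM => //; rewrite ge_max max_ge0 le_max ?mpq ?ppq orbT.
Qed.

(** At [p] neither factor is truncated and both grow strictly; this covers the boundary planes,
    where the product leaves 0. *)
Lemma quadrant_product_lt e p q :
  0 <= e * mcoord p -> 0 <= e * pcoord p ->
  0 < e * (mcoord q - mcoord p) -> 0 < e * (pcoord q - pcoord p) ->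
  quadrant_product e p < quadrant_product e q.
Proof.
rewrite !mulrBr !subr_gt0 => m0 p0 mpq ppq.
have mq := ltW (le_lt_trans m0 mpq); have pq := ltW (le_lt_trans p0 ppq).
by rewrite /quadrant_product !max_r // ltr_pM.
Qed.

(* [xget] picks a point of the orbit; by the previous invariance the choice is
   immaterial, and [o] is only the default for empty sets. *)
Definition orbit_product (e : R) (y : set 'cV[R]_3) : R :=
  quadrant_product e (xget o y).

Lemma orbit_productE e p :
  orbit_product e (orbit_of (cyclic_group gamma) p) = quadrant_product e p.
Proof.
rewrite /orbit_product.
have /mem_orbit[k ->] := xgetI o (orbit_refl p).
exact: quadrant_product_boost.
Qed.

Lemma no_CTC_in_quadrant c e t p :
  closed_timelike_curve (cyclic_group gamma) (~` C) c -> unit_itv R t ->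
  c t = orbit_of (cyclic_group gamma) p -> e = 1 \/ e = -1 ->
  0 <= e * mcoord p -> 0 <= e * pcoord p -> False.
Proof.
move=> [cc c01] It ct eE mp0 pp0.
have [e' e'E hc] := heading_constant cc.
(* [e] names the quadrant and [e'] the heading; [d] is the direction of the parameter in which the
   invariant function grows. *)
pose d := e' * e.
have dE : d = 1 \/ d = -1.
  rewrite /d; case: eE => ->; rewrite ?mulr1 ?mulrN1 //.
  by case: e'E => ->; rewrite ?opprK; auto.
have e'_d x y : e' * x * y = d * x * (e * y).
  by rewrite /d; case: eE => ->; ring.
have I0 : unit_itv R 0 by rewrite unit_itvE lexx ler01.
have I1 : unit_itv R 1 by rewrite unit_itvE lexx ler01.
have const s : unit_itv R s ->
    d * orbit_product e (c s) = d * orbit_product e (c 0).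
  apply: (@eq_constant_of_locally_nondecreasing R
    (fun s => d * orbit_product e (c s))); last by rewrite c01.
  move=> u Iu; have [U [f [_ _ cu _ fn]]] := heading_lift Iu (hc u Iu).
  apply: (@filterS _ (within (unit_itv R) u^')) fn => v [_ cv mv pv].
  rewrite cu cv !orbit_productE -mulrBr mulrA (mulrC (v - u)).
  rewrite e'_d in mv; rewrite e'_d in pv.
  (* Both [e]-signed coordinate increments carry the sign of [d * (v - u)]. *)
  have [dv|dv|dv] := ltgtP (d * (v - u)) 0.
  - rewrite nmulr_rge0 // subr_le0.
    rewrite nmulr_rgt0 // in mv; rewrite nmulr_rgt0 // in pv.
    by apply: quadrant_product_le; rewrite -opprB mulrN oppr_ge0 ltW.
  - rewrite pmulr_rge0 // subr_ge0.
    rewrite pmulr_rgt0 // in mv; rewrite pmulr_rgt0 // in pv.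
    by apply: quadrant_product_le; exact: ltW.
  - by rewrite dv mul0r.
(* Strict growth needs room on the [d] side of the parameter; if [t] is the end without room,
   closedness of [c] allows the other end instead. *)
have [t0 [It0 ct0 dt0]] : exists t0, [/\ unit_itv R t0,
    c t0 = orbit_of (cyclic_group gamma) p &
    (d = 1 /\ t0 < 1) \/ (d = -1 /\ 0 < t0)].
  move: (It); rewrite unit_itvE => /andP[t_ge0 t_le1].
  case: dE => dE.
    have [t1|t1] := ltP t 1; first by exists t; split=> //; left.
    exists 0; split=> //; last by left.
    by rewrite c01 -ct; congr c; apply/eqP; rewrite eq_le t1 t_le1.
  have [t1|t1] := ltP 0 t; first by exists t; split=> //; right.
  exists 1; split=> //; last by right.
  by rewrite -c01 -ct; congr c; apply/eqP; rewrite eq_le t1 t_ge0.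
have [U [f [_ _ cu _ fn]]] := heading_lift It0 (hc t0 It0).
have [s [Is ds [_ cs ms ps]]] := punctured_near_pick It0 dt0 fn.
rewrite e'_d pmulr_rgt0 // in ms; rewrite e'_d pmulr_rgt0 // in ps.
have [k ftE] : exists k, f t0 = boost k p by apply: orbit_eq; rewrite -ct0.
have : quadrant_product e (f t0) < quadrant_product e (f s).
  apply: quadrant_product_lt => //; rewrite ftE.
    by rewrite mcoord_boost mulrCA mulr_ge0 // ltW // exprz_gt0.
  by rewrite pcoord_boost mulrCA mulr_ge0 // ltW // exprz_gt0.
rewrite -2!orbit_productE -cu -cs.
have d0 : d != 0 by case: dE => ->; rewrite ?oppr_eq0 oner_eq0.
by rewrite (mulfI d0 (const _ Is)) (mulfI d0 (const _ It0)) ltxx.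
Qed.

(** * The regions in coordinates *)

Lemma CTC_points_coords p :
  CTC_points (cyclic_group gamma) (~` C) p <-> mcoord p * pcoord p < 0.
Proof.
split=> [[_ [c [t [cc It ct]]]]|]; last exact: segment_CTC.
rewrite ltNge; apply/negP => mp0.
have no := no_CTC_in_quadrant cc It ct.
have [m0|m0|m0] := ltgtP 0 (mcoord p).
- apply: (no 1); [by left | by rewrite mul1r ltW |].
  by rewrite mul1r -(pmulr_rge0 _ m0).
- apply: (no (-1)); [by right | by rewrite mulN1r oppr_ge0 ltW |].
  by rewrite mulN1r oppr_ge0 -(nmulr_rge0 _ m0).
(* On the plane [m = 0] the sign of the p-coordinate selects the closed quadrant. *)
have [p0|p0] := leP 0 (pcoord p).
  by apply: (no 1); rewrite ?mul1r -?m0 //; left.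
by apply: (no (-1)); rewrite ?mulN1r ?oppr_ge0 -?m0 ?(ltW p0) //; right.
Qed.

Lemma region_BE p : region_B o xm xp xo p <-> mcoord p * pcoord p < 0.
Proof.
split=> [[a [b [c [-> ab]]]]|mp0].
  by rewrite -/(frame_point a b c) mcoord_frame_point pcoord_frame_point.
by exists (mcoord p), (pcoord p), (ocoord p); split=> //;
  rewrite -[LHS]frame_pointK.
Qed.

Lemma region_GplusE p :
  region_Gplus o xm xp xo p <-> 0 <= mcoord p /\ 0 <= pcoord p.
Proof.
split=> [[a [b [c [-> a0 b0]]]]|[m0 p0]].
  by rewrite -/(frame_point a b c) mcoord_frame_point pcoord_frame_point.
by exists (mcoord p), (pcoord p), (ocoord p); split=> //;
  rewrite -[LHS]frame_pointK.
Qed.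

Lemma region_GminusE p :
  region_Gminus o xm xp xo p <-> mcoord p <= 0 /\ pcoord p <= 0.
Proof.
split=> [[a [b [c [-> a0 b0]]]]|[m0 p0]].
  by rewrite -/(frame_point a b c) mcoord_frame_point pcoord_frame_point.
by exists (mcoord p), (pcoord p), (ocoord p); split=> //;
  rewrite -[LHS]frame_pointK.
Qed.

Lemma CTC_regions :
  CTC_free_points (cyclic_group gamma) (~` C) =
    (region_Gplus o xm xp xo `|` region_Gminus o xm xp xo) `\` C /\
  CTC_points (cyclic_group gamma) (~` C) = region_B o xm xp xo.
Proof.
split; apply/seteqP; split=> p.
- move=> [Cp nT]; split=> //.
  have : 0 <= mcoord p * pcoord p.
    by rewrite leNgt; apply/negP => /CTC_points_coords.
  have [m0|m0|m0 _] := ltgtP 0 (mcoord p).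
  + by rewrite pmulr_rge0 // => p0; left; apply/region_GplusE; rewrite ltW.
  + by rewrite nmulr_rge0 // => p0; right; apply/region_GminusE; rewrite ltW.
  + have [p0|p0] := leP 0 (pcoord p).
      by left; apply/region_GplusE; rewrite -m0.
    by right; apply/region_GminusE; rewrite -m0 lexx ltW.
- move=> [G Cp]; split=> // /CTC_points_coords; rewrite ltNge => /negP; apply.
  case: G => [/region_GplusE|/region_GminusE] [m0 p0]; first exact: mulr_ge0.
  exact: mulr_le0.
- by move=> /CTC_points_coords/region_BE.
- by move=> /region_BE/CTC_points_coords.
Qed.

End Boosts.

(** * Reduction of a hyperbolic isometry to a boost *)

(** If [o] moves by [t *: xo], then applying [g] to [o - p], with [p] fixed, changes its product
    with [xo] by [t]; but [g] is an isometry fixing [xo], so [t = 0]. *)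
Lemma axis_point_fixed (R : realType) (gamma : 'cV[R]_3 -> 'cV[R]_3)
    (g : 'M[R]_3) (v xo o p : 'cV[R]_3) (C : set 'cV[R]_3) :
  in_O21 g -> (forall q, gamma q = g *m q + v) ->
  g *m xo = xo -> lorentz xo xo = 1 ->
  gamma p = p -> invariant_line gamma xo C -> C o -> gamma o = o.
Proof.
move=> gO gammaE go oo fp [[q CE] Cinv] Co.
have [t ot] : exists t, gamma o = o + t *: xo.
  have : C (gamma o) by rewrite -Cinv; exists o.
  move: Co; rewrite CE => -[s _ <-] [u _ <-]; exists (u - s).
  by rewrite scalerBl -addrA (addrC (s *: _)) subrK.
have gD : g *m (o - p) = o - p + t *: xo.
  by rewrite addrAC -ot -[in RHS]fp !gammaE mulmxBr opprD addrACA subrr addr0.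
have := gO (o - p) xo; rewrite gD go lorentzDl lorentzZl oo mulr1 => /eqP.
by rewrite -subr_eq0 addrAC subrr add0r ot => /eqP ->; rewrite scale0r addr0.
Qed.

Theorem proposition2p1 (R : realType)
    (gamma : 'cV[R]_3 -> 'cV[R]_3) (g : 'M[R]_3)
    (xm xp xo : 'cV[R]_3) (C : set 'cV[R]_3) (o : 'cV[R]_3)
    (hgamma : hyperbolic gamma g)
    (hfix : exists p : 'cV[R]_3, gamma p = p)
    (hframe : null_frame g xm xp xo)
    (hC : invariant_line gamma xo C)
    (ho : C o) :
  CTC_free_points (cyclic_group gamma) (~` C) =
    (region_Gplus o xm xp xo `|` region_Gminus o xm xp xo) `\` C /\
  CTC_points (cyclic_group gamma) (~` C) = region_B o xm xp xo.
Proof.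
have [[gO _ _] [v gammaE]] := hgamma.1.
have basis := null_frame_null_basis gO hframe.
have [l /andP[l0 l1] [gm gp]] := null_frame_ratio hframe.
have go : g *m xo = xo by case: hframe => _ [_ []].
have [p fp] := hfix.
have fo := axis_point_fixed gO gammaE go (nb_oo basis) fp hC ho.
have lN0 : l != 0 by rewrite gt_eqF.
have gammaB q : gamma q - o = g *m (q - o).
  by rewrite -{1}fo !gammaE mulmxBr opprD addrACA subrr addr0.
(* The m-coordinate pairs with [xp]; invariance of the form turns the eigenvalue [l^-1] of [xp] into
   the factor [l]. *)
have mg q : mcoord xp o (gamma q) = l * mcoord xp o q.
  rewrite /mcoord gammaB mulrN -(gO (q - o) xp) gp lorentzZr mulrA divff //.
  by rewrite mul1r.
have pg q : pcoord xm o (gamma q) = l^-1 * pcoord xm o q.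
  rewrite /pcoord gammaB mulrN -(gO (q - o) xm) gm lorentzZr mulrA mulVf //.
  by rewrite mul1r.
have og q : ocoord xo o (gamma q) = ocoord xo o q.
  by rewrite /ocoord gammaB -{1}go gO.
apply: (CTC_regions basis l0 l1) => q.
  by rewrite -[LHS](frame_pointK o basis) mg pg og.
have [[r CE] _] := hC.
(* The line is given with some base point [r]; here it is rebased at [o]. *)
have Co x : C x <-> exists t, x = o + t *: xo.
  move: ho; rewrite CE => -[s _ <-].
  split=> [[t _ <-]|[t ->]].
    by exists (t - s); rewrite scalerBl -addrA (addrC (s *: _)) subrK.
  by exists (s + t) => //; rewrite scalerDl addrA.
rewrite Co; split=> [[t ->]|[m0 p0]].
  rewrite /mcoord /pcoord addrC addKr !lorentzZl !(lorentzC xo).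
  by rewrite (nb_mo basis) (nb_po basis) mulr0 oppr0.
exists (ocoord xo o q); rewrite -[LHS](frame_pointK o basis) m0 p0.
by rewrite /frame_point !scale0r !add0r.
Qed.
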